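(* Let $G$ and $H$ be graphs with $G$ connected. Then $$\xi(G \odot H) \ge \beta(\widehat{G})\,\mathrm{n}(H) + \alpha(\widehat{G}) + \beta^*(G).$$
   Context: All graphs are finite, simple and undirected; $\mathrm{n}(H)$ denotes the order of $H$. For a connected graph $\Gamma$, a set $S\subseteq V(\Gamma)$ is a distance-equalizer set if for every two distinct $u,v\in V(\Gamma)\setminus S$ there is $w\in S$ with $d_\Gamma(w,u)=d_\Gamma(w,v)$; $\xi(\Gamma)$ is the minimum cardinality of a distance-equalizer set of $\Gamma$. For $V(G)=\{v_1,\dots,v_n\}$, the corona product $G\odot H$ is obtained from $G$ and $n$ pairwise disjoint copies $H_1,\dots,H_n$ of $H$ by joining $v_i$ to every vertex of $H_i$, for each $i$. For distinct $u,v\in V(G)$ the bisector is $B_G(u\mid v)=\{w\in V(G): d_G(w,u)=d_G(w,v)\}$. The empty bisector graph $\widehat{G}$ has vertex set $V(G)$, with $u,v$ adjacent iff $B_G(u\mid v)=\varnothing$. $\alpha$ denotes the independence number and $\beta$ the vertex cover number. A pair $(X,Y)$ of subsets of $V(G)$ with $X\cup Y=V(G)$ is a forward-equalized pair of $G$ if for every $(u,v)\in (X\setminus Y)\times(Y\setminus X)$ there exists $w\in V(G)$ with $d_G(w,u)=d_G(w,v)+1$. Finally $\beta^*(G)=\min\{|X\cap Y| : X,Y \text{ are vertex covers of } \widehat{G} \text{ and } (X,Y) \text{ is a forward-equalized pair of } G\}$. *)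

(* Defs.v *)
From mathcomp Require Import all_boot.

Set Implicit Arguments.
Unset Strict Implicit.
Unset Printing Implicit Defensive.

(* Graphs are non-null, as usual: the lower bound on the corona product fails
   when the second factor has no vertices. *)
Record sgraph := SGraph {
  vertex :> finType;
  adj : rel vertex;
  adj_sym : symmetric adj;
  adj_irrefl : irreflexive adj;
  order_gt0 : 0 < #|vertex| }.

Definition connected (G : sgraph) : Prop :=
  forall x y : G, connect (@adj G) x y.

(* The least length of a walk from [x] to [y]; a shortest walk has fewer than
   [#|G|] edges.  The value is [#|G|] when there is no walk at all. *)
Definition dist (G : sgraph) (x y : G) : nat :=
  find (fun k => [exists p : k.-tuple G, path (@adj G) x p && (last x p == y)])
       (iota 0 #|G|).

Definition distance_equalizer (G : sgraph) (S : {set G}) : bool :=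
  [forall u, forall v,
     [&& u \notin S, v \notin S & u != v] ==>
     [exists w in S, dist w u == dist w v]].

Lemma distance_equalizerT (G : sgraph) : distance_equalizer [set: G].
Proof. by apply/forallP=> u; apply/forallP=> v; rewrite inE. Qed.

(* By [distance_equalizerT] the minimum is over a nonempty family. *)
Definition xi (G : sgraph) : nat :=
  #|[arg min_(S < [set: G] | distance_equalizer S) #|S| ]|.

Section Corona.
Variables G H : sgraph.

(* [inl v] is the vertex [v] of [G]; [inr (v, h)] is the vertex [h] in the copy
   of [H] attached to [v]. *)
Definition corona_adj : rel (G + G * H) := fun x y =>
  match x, y with
  | inl u, inl v => adj u v
  | inl u, inr (v, _) => u == v
  | inr (u, _), inl v => u == v
  | inr (u, h), inr (v, k) => (u == v) && adj h k
  end.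

Lemma corona_sym : symmetric corona_adj.
Proof.
by case=> [u|[u h]] [v|[v k]] /=; rewrite 1?adj_sym // eq_sym // adj_sym.
Qed.

Lemma corona_irrefl : irreflexive corona_adj.
Proof. by case=> [u|[u h]] /=; rewrite adj_irrefl ?andbF. Qed.

Lemma corona_order_gt0 : 0 < #|{: G + G * H}|.
Proof. by rewrite card_sum addn_gt0 order_gt0. Qed.

Definition corona : sgraph := SGraph corona_sym corona_irrefl corona_order_gt0.

End Corona.

Section EmptyBisectorGraph.
Variable G : sgraph.

Definition bisector (u v : G) : {set G} := [set w | dist w u == dist w v].

Definition ebg_adj : rel G := fun u v => (u != v) && (bisector u v == set0).

Lemma bisectorC (u v : G) : bisector u v = bisector v u.
Proof. by apply/setP=> w; rewrite !inE eq_sym. Qed.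

Lemma ebg_sym : symmetric ebg_adj.
Proof. by move=> u v; rewrite /ebg_adj eq_sym bisectorC. Qed.

Lemma ebg_irrefl : irreflexive ebg_adj.
Proof. by move=> u; rewrite /ebg_adj eqxx. Qed.

Definition empty_bisector_graph : sgraph :=
  SGraph ebg_sym ebg_irrefl (order_gt0 G).

End EmptyBisectorGraph.

Definition independent (G : sgraph) (S : {set G}) : bool :=
  [forall u in S, forall v in S, ~~ adj u v].

Definition alpha (G : sgraph) : nat :=
  \max_(S : {set G} | independent S) #|S|.

Definition vertex_cover (G : sgraph) (S : {set G}) : bool :=
  [forall u, forall v, adj u v ==> (u \in S) || (v \in S)].

Lemma vertex_coverT (G : sgraph) : vertex_cover [set: G].
Proof. by apply/forallP=> u; apply/forallP=> v; rewrite inE implybT. Qed.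

(* By [vertex_coverT] the minimum is over a nonempty family. *)
Definition beta (G : sgraph) : nat :=
  #|[arg min_(S < [set: G] | vertex_cover S) #|S| ]|.

Definition forward_equalized (G : sgraph) (X Y : {set G}) : bool :=
  (X :|: Y == [set: G]) &&
  [forall u in X :\: Y, forall v in Y :\: X,
     exists w : G, dist w u == (dist w v).+1].

Definition beta_star_feasible (G : sgraph) (p : {set G} * {set G}) : bool :=
  [&& @vertex_cover (empty_bisector_graph G) p.1,
      @vertex_cover (empty_bisector_graph G) p.2
    & forward_equalized p.1 p.2].

Lemma beta_star_feasibleT (G : sgraph) :
  beta_star_feasible ([set: G], [set: G]).
Proof.
apply/and3P; split; try exact: (@vertex_coverT (empty_bisector_graph G)).
rewrite /forward_equalized setUT eqxx /=.
by apply/forallP=> u; rewrite !inE.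
Qed.

(* By [beta_star_feasibleT] the minimum is over a nonempty family. *)
Definition beta_star (G : sgraph) : nat :=
  let p := [arg min_(p < ([set: G], [set: G]) | beta_star_feasible p)
              #|p.1 :&: p.2| ] in
  #|p.1 :&: p.2|.

(* Main.v *)
Require Import Defs.
From mathcomp Require Import all_boot.
From mathcomp Require Import zify.

(** Let [S] be a distance-equalizer set of the corona product.  Let [U] be the
    set of vertices of [G] whose copy of [H] lies inside [S], [X] the set of
    those whose copy meets [S], and [Y] the trace of [S] on [G].  Distances in
    the corona are distances in [G] plus the number of endpoints outside [G]
    (except inside a single copy), so [U] and [Y] are vertex covers of the empty
    bisector graph, hence so is [X] (which contains [U]), and [(X, Y)] is
    forward-equalized.  Each vertex of [U] contributes a whole copy of [H] to
    [S] and each vertex of [X :\: U] at least one vertex, so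
    [|S| >= |U| (|H| - 1) + |X| + |Y|], where [|X| + |Y| = |G| + |X :&: Y|] and
    [|G| = alpha + beta]. *)

Set Implicit Arguments.
Unset Strict Implicit.
Unset Printing Implicit Defensive.

Lemma card_set_sum (T U : finType) (A : {set T + U}) :
  #|A| = #|[set x | inl x \in A]| + #|[set y | inr y \in A]|.
Proof. by rewrite -sum1_card big_sumType /= !sum1dep_card. Qed.

Lemma card_set_prod (T U : finType) (A : {set T * U}) :
  #|A| = \sum_x #|[set y | (x, y) \in A]|.
Proof.
rewrite -sum1_card (eq_bigl (fun p => (p.1, p.2) \in A)) => [|[] //].
rewrite -(pair_big_dep xpredT (fun x y => (x, y) \in A) (fun _ _ => 1)) /=.
by apply: eq_bigr => x _; rewrite sum1dep_card.
Qed.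

Lemma sum_card_ge_full_nonempty (T U : finType) (F : T -> {set U}) :
  #|[set t | F t == setT]| * #|U|.-1 + #|[set t | F t != set0]|
  <= \sum_t #|F t|.
Proof.
rewrite -sum_nat_const -sum1dep_card big_mkcond /= [X in _ + X]big_mkcond /=.
rewrite -big_split leq_sum // => t _; rewrite inE -card_gt0.
by case: eqP => [->|_]; rewrite ?cardsT /=; case: ifP => //; lia.
Qed.

Section Distance.
Variable G : sgraph.
Implicit Types (x y z : G) (p : seq G).

Lemma dist_le_card x y : dist x y <= #|G|.
Proof. by rewrite -[leqRHS](size_iota 0) find_size. Qed.

Lemma dist_le_size x p : path (@adj G) x p -> dist x (last x p) <= size p.
Proof.
move=> xp; rewrite /dist; set is_walk_length := fun k => _.
have size_p_walk : is_walk_length (size p).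
  by apply/existsP; exists (in_tuple p); rewrite xp eqxx.
case: (ltnP (size p) #|G|) => [lt_pG|le_Gp]; last first.
  exact: leq_trans (dist_le_card _ _) le_Gp.
rewrite leqNgt; apply/negP => /(before_find 0).
by rewrite nth_iota // add0n size_p_walk.
Qed.

Lemma dist_lt_card x y : connect (@adj G) x y -> dist x y < #|G|.
Proof.
case/connectP=> _ /shortenP[p xp up _] ->.
apply: leq_trans (max_card (mem (x :: p))).
by rewrite (card_uniqP up) ltnS dist_le_size.
Qed.

Lemma shortest_path x y :
  dist x y < #|G| ->
  exists p, [/\ path (@adj G) x p, last x p = y & size p = dist x y].
Proof.
move=> lt_dG; have := lt_dG; rewrite -[ltnRHS](size_iota 0) -has_find.
move/(nth_find 0); rewrite nth_iota // => /existsP[p /andP[xp /eqP xy]].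
by exists p; rewrite size_tuple.
Qed.

Lemma dist_eq0 x y : (dist x y == 0) = (x == y).
Proof.
apply/eqP/eqP => [d0|->]; last first.
  by apply/eqP; rewrite -leqn0 (@dist_le_size y [::]).
have [|p [_ last_p]] := @shortest_path x y; first by rewrite d0 Defs.order_gt0.
by rewrite d0 -last_p => /size0nil->.
Qed.

Lemma distxx x : dist x x = 0.
Proof. by apply/eqP; rewrite dist_eq0. Qed.

Lemma dist_triangle x y z : dist x z <= dist x y + dist y z.
Proof.
have [le_Gd|lt_dG] := leqP #|G| (dist x y + dist y z).
  exact: leq_trans (dist_le_card x z) le_Gd.
have [|p [xp last_p <-]] := @shortest_path x y; first by lia.
have [|q [yq <- <-]] := @shortest_path y z; first by lia.
by rewrite -last_p -last_cat -size_cat dist_le_size // cat_path xp last_p.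
Qed.

Lemma dist_adj x y : adj x y -> dist x y <= 1.
Proof. by move=> xy; apply: (@dist_le_size x [:: y]); rewrite /= xy. Qed.

Lemma dist_adjr x y z : adj y z -> dist x z <= (dist x y).+1.
Proof. by move/dist_adj => yz; have := dist_triangle x y z; lia. Qed.

Lemma leq_dist_lipschitz (f : G -> nat) x y :
    (forall a b, adj a b -> f b <= (f a).+1) -> connect (@adj G) x y ->
  f y <= f x + dist x y.
Proof.
move=> f_lip /dist_lt_card/shortest_path[p [xp <- <-]].
elim: p x xp => [|z p IHp] x /=; first by rewrite addn0.
by case/andP=> /f_lip xz /IHp; lia.
Qed.

End Distance.

Section Homomorphism.
Variables (G K : sgraph) (f : G -> K).
Hypothesis f_homo : {homo f : x y / adj x y}.

Lemma homo_connect :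
  {homo f : x y / connect (@adj G) x y >-> connect (@adj K) x y}.
Proof.
move=> x _ /connectP[p xp ->]; apply/connectP; exists (map f p).
  exact: homo_path xp.
by rewrite last_map.
Qed.

Lemma dist_homo x y : connect (@adj G) x y -> dist (f x) (f y) <= dist x y.
Proof.
case/dist_lt_card/shortest_path=> p [xp <- <-].
by rewrite -last_map -(size_map f) dist_le_size // (homo_path f_homo).
Qed.

End Homomorphism.

Section Extrema.
Variable G : sgraph.
Implicit Types (S A B : {set G}) (u v w : G).

Lemma distance_equalizerP S :
  reflect (forall u v, u \notin S -> v \notin S -> u != v ->
             exists2 w, w \in S & dist w u = dist w v)
          (distance_equalizer S).
Proof.
apply: (iffP 'forall_forallP) => eqS u v => [uS vS uv|].
  have := eqS u v; rewrite uS vS uv.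
  by case/exists_inP=> w wS /eqP; exists w.
apply/implyP=> /and3P[uS vS uv]; have [w wS dw] := eqS u v uS vS uv.
by apply/exists_inP; exists w; rewrite ?dw.
Qed.

Lemma xi_attained : exists2 S : {set G}, distance_equalizer S & #|S| = xi G.
Proof.
rewrite /xi; case: arg_minnP => [|S eqS _]; last by exists S.
exact: distance_equalizerT.
Qed.

Lemma vertex_coverP A :
  reflect (forall u v, adj u v -> (u \in A) || (v \in A)) (vertex_cover A).
Proof.
by apply: (iffP 'forall_forallP) => covA u v; apply/implyP/covA.
Qed.

Lemma vertex_coverS A B : A \subset B -> vertex_cover A -> vertex_cover B.
Proof.
move=> /subsetP sAB /vertex_coverP covA; apply/vertex_coverP => u v.
by case/covA/orP=> /sAB->; rewrite ?orbT.
Qed.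

Lemma vertex_coverC A : vertex_cover (~: A) = independent A.
Proof.
apply/vertex_coverP/forall_inP => [covA u uA|indA u v].
  apply/forall_inP => v vA; apply/negP => /covA.
  by rewrite !inE uA vA.
apply: contraTT; rewrite !inE negb_or !negbK => /andP[/indA/forall_inP].
exact.
Qed.

Lemma beta_le A : vertex_cover A -> beta G <= #|A|.
Proof.
by rewrite /beta; case: arg_minnP => [|B _ minB /minB //]; apply: vertex_coverT.
Qed.

Lemma beta_attained : exists2 A : {set G}, vertex_cover A & #|A| = beta G.
Proof.
rewrite /beta; case: arg_minnP => [|A covA _]; last by exists A.
exact: vertex_coverT.
Qed.

Lemma alpha_add_beta : alpha G + beta G = #|G|.
Proof.
apply/eqP; rewrite eqn_leq; apply/andP; split.
  have [A _ cardA] := beta_attained.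
  have le_bG : beta G <= #|G| by rewrite -cardA max_card.
  rewrite addnC -leq_subRL //; apply/bigmax_leqP => B.
  by rewrite -vertex_coverC => /beta_le; have := cardsC B; lia.
have [A covA <-] := beta_attained; rewrite -(cardsC A) addnC leq_add2r.
by apply: leq_bigmax_cond; rewrite -vertex_coverC setCK.
Qed.

Lemma beta_star_le A B : beta_star_feasible (A, B) -> beta_star G <= #|A :&: B|.
Proof.
rewrite /beta_star; case: arg_minnP => [|p _ minp /minp //].
exact: beta_star_feasibleT.
Qed.

Lemma ebg_adj_dist_neq u v w : ebg_adj u v -> dist w u != dist w v.
Proof.
case/andP=> _; apply: contraTneq => duv; apply/set0Pn.
by exists w; rewrite inE duv.
Qed.

End Extrema.

Section Corona.
Variables G H : sgraph.
Implicit Types (a b c w : corona G H) (u v : G) (h k : H).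

Definition base_vertex u : corona G H := inl u.

Definition copy_vertex u h : corona G H := inr (u, h).

Definition corona_proj a : G :=
  match a with inl u => u | inr (u, _) => u end.

Definition in_copy a : bool := if a is inr _ then true else false.

Definition same_copy a b : bool :=
  [&& in_copy a, in_copy b & corona_proj a == corona_proj b].

Section Distance.
Hypothesis G_connected : connected G.

Lemma base_vertex_homo : {homo base_vertex : u v / adj u v}.
Proof. by []. Qed.

Lemma connect_base_vertex a : connect (@adj _) a (base_vertex (corona_proj a)).
Proof. by case: a => [u|[u h]] //; apply/connect1/eqxx. Qed.

Lemma corona_connected : connected (corona G H).
Proof.
move=> a b; apply: connect_trans (connect_base_vertex a) _.
rewrite (sym_connect_sym (@adj_sym _)).
apply: connect_trans (connect_base_vertex b) _.
exact: (homo_connect base_vertex_homo).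
Qed.

Lemma corona_dist_le a b :
  dist a b <= in_copy a + dist (corona_proj a) (corona_proj b) + in_copy b.
Proof.
have to_base : dist a (base_vertex (corona_proj a)) <= in_copy a.
  by case: a => [u|[u h]]; rewrite ?distxx ?dist_adj //; apply: eqxx.
have of_base : dist (base_vertex (corona_proj b)) b <= in_copy b.
  by case: b => [u|[u h]]; rewrite ?distxx ?dist_adj //; apply: eqxx.
apply: leq_trans (dist_triangle _ (base_vertex (corona_proj b)) _) _.
apply: leq_add of_base; apply: leq_trans (dist_triangle _ _ _) _.
exact: leq_add to_base (dist_homo base_vertex_homo (G_connected _ _)).
Qed.

Lemma corona_dist a b :
  ~~ same_copy a b ->
  dist a b = in_copy a + dist (corona_proj a) (corona_proj b) + in_copy b.
Proof.
pose dist_from_a c := if same_copy a c then 0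
  else in_copy a + dist (corona_proj a) (corona_proj c) + in_copy c.
have dist_from_a_lip c e : adj c e -> dist_from_a e <= (dist_from_a c).+1.
  rewrite /dist_from_a /same_copy.
  case: c e => [u|[u h]] [v|[v k]] /=; rewrite ?andbF /=.
  - by move/(dist_adjr (corona_proj a)); lia.
  - by move/eqP->; case: ifP; lia.
  - move/eqP->; case: ifP => [/andP[-> /eqP->]|_]; last by lia.
    by rewrite distxx.
  - by case/andP=> /eqP-> _; case: ifP.
have dist_from_aa : dist_from_a a = 0.
  by rewrite /dist_from_a /same_copy eqxx andbT andbb distxx; case: (in_copy a).
move=> apart; apply/eqP; rewrite eqn_leq corona_dist_le /=.
have := leq_dist_lipschitz dist_from_a_lip (corona_connected a b).
by rewrite dist_from_aa /dist_from_a (negPf apart).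
Qed.

Lemma equidistant_not_same_copy w a b :
    corona_proj a != corona_proj b -> in_copy a = in_copy b ->
    dist w a = dist w b ->
  ~~ same_copy w a.
Proof.
move=> neq_ab in_copy_ab dab; apply/negP => /and3P[in_w in_a /eqP proj_wa].
have := corona_dist_le w a; rewrite dab corona_dist; last first.
  by rewrite /same_copy proj_wa (negPf neq_ab) !andbF.
have : 0 < dist (corona_proj a) (corona_proj b) by rewrite lt0n dist_eq0.
by rewrite proj_wa distxx -in_copy_ab in_w in_a; lia.
Qed.

Lemma corona_equidistant w a b :
    corona_proj a != corona_proj b -> in_copy a = in_copy b ->
    dist w a = dist w b ->
  dist (corona_proj w) (corona_proj a) = dist (corona_proj w) (corona_proj b).
Proof.
move=> neq_ab in_copy_ab dab; have apart_wa := @equidistant_not_same_copy w a b.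
have apart_wb := @equidistant_not_same_copy w b a.
move: (dab); rewrite !corona_dist ?apart_wa ?apart_wb //.
  by rewrite in_copy_ab => /addIn/addnI.
by rewrite eq_sym.
Qed.

End Distance.

Section Trace.
Variable S : {set corona G H}.

Definition copy_trace u : {set H} := [set h | copy_vertex u h \in S].
Definition full_copies : {set G} := [set u | copy_trace u == setT].
Definition met_copies : {set G} := [set u | copy_trace u != set0].
Definition base_trace : {set G} := [set u | base_vertex u \in S].

Lemma full_copiesPn u :
  reflect (exists h, copy_vertex u h \notin S) (u \notin full_copies).
Proof.
rewrite inE -subTset; apply: (iffP subsetPn) => [[h _]|[h uhS]].
  by rewrite inE; exists h.
by exists h; rewrite inE.
Qed.

Lemma met_copiesP u :
  reflect (exists h, copy_vertex u h \in S) (u \in met_copies).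
Proof.
by rewrite inE; apply: (iffP (set0Pn _)) => -[h uhS]; exists h;
  rewrite inE in uhS *.
Qed.

Lemma full_sub_met : full_copies \subset met_copies.
Proof.
apply/subsetP => u; rewrite !inE => /eqP->.
by rewrite -card_gt0 cardsT Defs.order_gt0.
Qed.

Lemma leq_card_traces :
  #|full_copies| * #|H|.-1 + #|met_copies| + #|base_trace| <= #|S|.
Proof.
rewrite [#|S|]card_set_sum addnC leq_add2l card_set_prod.
apply: leq_trans (sum_card_ge_full_nonempty copy_trace) _.
apply: leq_sum => u _.
by apply/eq_leq/eq_card => h; rewrite !inE.
Qed.

Hypotheses (G_connected : connected G) (S_equalizer : distance_equalizer S).

Lemma equalizer_covers_ebg_edge a b :
    in_copy a = in_copy b -> ebg_adj (corona_proj a) (corona_proj b) ->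
  (a \in S) || (b \in S).
Proof.
move=> in_copy_ab edge.
have neq_ab : corona_proj a != corona_proj b by case/andP: edge.
apply: contraT; rewrite negb_or => /andP[aS bS].
have [|w _ dab] := distance_equalizerP _ S_equalizer a b aS bS.
  by apply: contraNneq neq_ab => ->.
have := ebg_adj_dist_neq (corona_proj w) edge.
by rewrite (corona_equidistant G_connected neq_ab in_copy_ab dab) eqxx.
Qed.

Lemma vertex_cover_full_copies :
  vertex_cover (full_copies : {set empty_bisector_graph G}).
Proof.
apply/vertex_coverP => u v uv; apply: contraT; rewrite negb_or.
case/andP=> /full_copiesPn[h /negPf uhS] /full_copiesPn[k /negPf vkS].
have := @equalizer_covers_ebg_edge (copy_vertex u h) (copy_vertex v k).
by rewrite uhS vkS; apply.
Qed.

Lemma vertex_cover_met_copies :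
  vertex_cover (met_copies : {set empty_bisector_graph G}).
Proof.
apply: vertex_coverS vertex_cover_full_copies; exact: full_sub_met.
Qed.

Lemma vertex_cover_base_trace :
  vertex_cover (base_trace : {set empty_bisector_graph G}).
Proof.
apply/vertex_coverP => u v uv; rewrite !inE.
exact: equalizer_covers_ebg_edge.
Qed.

Lemma exists_forward_vertex u v :
    u \notin base_trace -> v \notin met_copies ->
  exists w : G, dist w u = (dist w v).+1.
Proof.
have /card_gt0P[h _] := Defs.order_gt0 H; rewrite inE => uS vX.
have vhS : copy_vertex v h \notin S.
  by apply: contra vX => vhS; apply/met_copiesP; exists h.
have [//|w wS] := distance_equalizerP _ S_equalizer _ _ uS vhS.
rewrite !corona_dist //=; first by exists (corona_proj w); lia.
- apply: contra vX; case: w wS => [|[x k]] //= xkS /eqP/= <-.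
  by apply/met_copiesP; exists k.
- by rewrite /same_copy andbF.
Qed.

Lemma forward_equalized_traces : forward_equalized met_copies base_trace.
Proof.
apply/andP; split.
  apply/eqP/setP => v; rewrite [RHS]inE in_setU.
  apply: contraT; rewrite negb_or => /andP[vX vY].
  by have [w] := exists_forward_vertex vY vX; lia.
apply/forall_inP => u /setDP[_ uY]; apply/forall_inP => v /setDP[_ vX].
have [w dw] := exists_forward_vertex uY vX.
by apply/existsP; exists w; apply/eqP.
Qed.

Lemma beta_star_feasible_traces : beta_star_feasible (met_copies, base_trace).
Proof.
apply/and3P; split; first exact: vertex_cover_met_copies.
  exact: vertex_cover_base_trace.
exact: forward_equalized_traces.
Qed.

End Trace.
End Corona.

Theorem theorem17 (G H : sgraph) (hG : connected G) :
  xi (corona G H) >=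
    beta (empty_bisector_graph G) * #|H| + alpha (empty_bisector_graph G)
    + beta_star G.
Proof.
have [S S_equalizer <-] := xi_attained (corona G H).
set U := full_copies S; set X := met_copies S; set Y := base_trace S.
have beta_le_U : beta (empty_bisector_graph G) <= #|U|.
  exact/beta_le/vertex_cover_full_copies.
have beta_star_le_XY : beta_star G <= #|X :&: Y|.
  exact/beta_star_le/beta_star_feasible_traces.
have XY_cover : X :|: Y = setT.
  by have /andP[/eqP] := forward_equalized_traces hG S_equalizer.
have gallai := alpha_add_beta (empty_bisector_graph G).
apply: leq_trans (leq_card_traces S).
rewrite -[leqRHS]addnA -cardsUI -/U -/X -/Y XY_cover cardsT -[#|G|]gallai.
rewrite addnA leq_add // -[X in _ * X](prednK (Defs.order_gt0 H)) mulnS.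
by rewrite addnC addnA [leqRHS]addnC leq_add2l leq_mul2r beta_le_U orbT.
Qed.
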